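(* Let $\mathcal{P}$ be a convex family of probability distributions over $\mathcal{Z}$ such that every affine function $\mathcal{P}\to\mathbb{R}$ is presentable. Let $H:\mathcal{P}\to\mathbb{R}$ be such that for every $Q\in\mathcal{P}$ there exists an affine function $\phi_Q:\mathcal{P}\to\mathbb{R}$ with $$H(P)\le\phi_Q(P)\ \text{ for all }P\in\mathcal{P},\qquad H(Q)=\phi_Q(Q).$$ Then $H$ is a coherent uncertainty function. More precisely, if $f_Q:\mathcal{Z}\to\mathbb{R}$ satisfies $\phi_Q(P)=E_P\{f_Q(Z)\}$ for all $P\in\mathcal{P}$, then $S(z,Q):=f_Q(z)$ is a proper scoring rule over $\mathcal{P}$ with $S(P,P)=H(P)$ for all $P\in\mathcal{P}$, and the associated discrepancy function is $D(P,Q)=\phi_Q(P)-H(P)$.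
   Context: $\mathcal{P}$ is convex in the sense that $E(\tilde P)\in\mathcal{P}$ for every random element $\tilde P$ of $\mathcal{P}$. A function $F:\mathcal{P}\to\mathcal{V}$ into an affine space is affine if $E\{F(\tilde P)\}=F\{E(\tilde P)\}$ for every random element $\tilde P$ of $\mathcal{P}$; it is presentable if there is a function $f:\mathcal{Z}\to\mathcal{V}$ with $F(P)=E_P\{f(Z)\}$ for all $P\in\mathcal{P}$. A loss function $L(z,a)$, $z\in\mathcal{Z}$, $a\in\mathcal{A}$ ($\mathcal{A}$ an arbitrary action space) has domain $\mathcal{P}$ if $L(P,a):=E_P\{L(Z,a)\}$ exists (possibly infinite) for all $P\in\mathcal{P}$, $a\in\mathcal{A}$, and $\inf_{a\in\mathcal{A}}L(P,a)$ is finite and attained for each $P\in\mathcal{P}$. $H:\mathcal{P}\to\mathbb{R}$ is a coherent uncertainty function if $H(P)=\inf_{a\in\mathcal{A}}L(P,a)$, $P\in\mathcal{P}$, for some action space $\mathcal{A}$ and loss function $L$ with domain $\mathcal{P}$. A scoring rule $S(z,Q)$ ($z\in\mathcal{Z}$, $Q\in\mathcal{P}$), with $S(P,Q):=E_P\{S(Z,Q)\}$, is proper over $\mathcal{P}$ if $S(P,P)$ is finite and $S(P,P)\le S(P,Q)$ for all $P,Q\in\mathcal{P}$; its associated uncertainty function is $S(P,P)$ and its associated discrepancy function is $D(P,Q):=S(P,Q)-S(P,P)$. *)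

(* Defs.v *)
From HB Require Import structures.
From mathcomp Require Import all_boot all_order all_algebra.
From mathcomp Require Import all_classical all_reals all_analysis.

Set Implicit Arguments.
Unset Strict Implicit.
Unset Printing Implicit Defensive.
Import Order.TTheory GRing.Theory Num.Theory.

Local Open Scope classical_set_scope.
Local Open Scope ring_scope.
Local Open Scope ereal_scope.

(* A family of distributions over Z is a set PP of elements of
   [pprobability Z R]; functions on PP are represented by functions on the whole
   of [pprobability Z R], and only their values on PP are ever used. *)

(* The expectation of [f] exists, possibly infinite. The library integral is
   total, with +oo - +oo = -oo, hence the condition on the integrals of the
   positive and negative parts. When 'E_mu[f] is moreover finite, this amounts
   to integrability of [f]. *)
Definition has_expectation (R : realType) (d : measure_display)
    (T : measurableType d) (mu : probability T R) (f : T -> R) : Prop :=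
  measurable_fun setT f /\
  (\int[mu]_x (EFin \o f)^\+ x) +? (- \int[mu]_x (EFin \o f)^\- x).

(* [pprobability Z R] carries the sigma-algebra generated by the evaluations
   P |-> P A, with A measurable. *)
Definition random_element (R : realType) (d d' : measure_display)
    (Z : measurableType d) (Omega : measurableType d')
    (PP : set (pprobability Z R)) (X : Omega -> pprobability Z R) : Prop :=
  measurable_fun setT X /\ forall w, PP (X w).

(* [M] is the mixture E(X). Library measures also take (irrelevant) values on
   non-measurable sets, so that E(X) is characterized by its values on the
   measurable ones. *)
Definition is_mean (R : realType) (d d' : measure_display)
    (Z : measurableType d) (Omega : measurableType d')
    (mu : probability Omega R) (X : Omega -> pprobability Z R)
    (M : pprobability Z R) : Prop :=
  forall A : set Z, measurable A ->
    (M : probability Z R) A = \int[mu]_w (X w : probability Z R) A.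

Definition convex_family (R : realType) (d : measure_display)
    (Z : measurableType d) (PP : set (pprobability Z R)) : Prop :=
  forall (d' : measure_display) (Omega : measurableType d')
    (mu : probability Omega R) (X : Omega -> pprobability Z R),
    random_element PP X -> exists2 M, PP M & is_mean mu X M.

(* Taking X constant shows that an affine function does not distinguish two
   elements of PP that agree on measurable sets. *)
Definition affine_on (R : realType) (d : measure_display)
    (Z : measurableType d) (PP : set (pprobability Z R))
    (F : pprobability Z R -> R) : Prop :=
  forall (d' : measure_display) (Omega : measurableType d')
    (mu : probability Omega R) (X : Omega -> pprobability Z R)
    (M : pprobability Z R),
    random_element PP X -> PP M -> is_mean mu X M ->
    has_expectation mu (F \o X) /\ 'E_mu[F \o X] = (F M)%:E.

Definition presents (R : realType) (d : measure_display)
    (Z : measurableType d) (PP : set (pprobability Z R))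
    (f : Z -> R) (F : pprobability Z R -> R) : Prop :=
  forall P : pprobability Z R, PP P ->
    has_expectation P f /\ 'E_P[f] = (F P)%:E.

Definition presentable (R : realType) (d : measure_display)
    (Z : measurableType d) (PP : set (pprobability Z R))
    (F : pprobability Z R -> R) : Prop :=
  exists f : Z -> R, presents PP f F.

Definition expected_loss (R : realType) (d : measure_display)
    (Z : measurableType d) (A : Type) (L : Z -> A -> R)
    (P : pprobability Z R) (a : A) : \bar R :=
  'E_P[L ^~ a].

Definition bayes_loss (R : realType) (d : measure_display)
    (Z : measurableType d) (A : Type) (L : Z -> A -> R)
    (P : pprobability Z R) : \bar R :=
  ereal_inf (range (expected_loss L P)).

Definition has_domain (R : realType) (d : measure_display)
    (Z : measurableType d) (A : Type) (L : Z -> A -> R)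
    (PP : set (pprobability Z R)) : Prop :=
  (forall (P : pprobability Z R) (a : A), PP P ->
     has_expectation P (L ^~ a)) /\
  (forall P : pprobability Z R, PP P ->
     bayes_loss L P \is a fin_num /\
     exists a : A, expected_loss L P a = bayes_loss L P).

Definition coherent_uncertainty (R : realType) (d : measure_display)
    (Z : measurableType d) (PP : set (pprobability Z R))
    (H : pprobability Z R -> R) : Prop :=
  exists (A : Type) (L : Z -> A -> R),
    has_domain L PP /\
    forall P : pprobability Z R, PP P -> (H P)%:E = bayes_loss L P.

Definition expected_score (R : realType) (d : measure_display)
    (Z : measurableType d) (S : Z -> pprobability Z R -> R)
    (P Q : pprobability Z R) : \bar R :=
  'E_P[S ^~ Q].

Definition proper_scoring_rule (R : realType) (d : measure_display)
    (Z : measurableType d) (PP : set (pprobability Z R))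
    (S : Z -> pprobability Z R -> R) : Prop :=
  forall P Q : pprobability Z R, PP P -> PP Q ->
    [/\ has_expectation P (S ^~ Q),
        expected_score S P P \is a fin_num &
        expected_score S P P <= expected_score S P Q].

Definition discrepancy (R : realType) (d : measure_display)
    (Z : measurableType d) (S : Z -> pprobability Z R -> R)
    (P Q : pprobability Z R) : \bar R :=
  expected_score S P Q - expected_score S P P.

Definition affine_support (R : realType) (d : measure_display)
    (Z : measurableType d) (PP : set (pprobability Z R))
    (H : pprobability Z R -> R) (Q : pprobability Z R)
    (phi : pprobability Z R -> R) : Prop :=
  [/\ affine_on PP phi,
      (forall P : pprobability Z R, PP P -> (H P <= phi P)%R) &
      H Q = phi Q].

(* Main.v *)
Require Import Defs.
From mathcomp Require Import all_boot all_order all_algebra.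
From mathcomp Require Import all_classical all_reals all_analysis.
Import Order.TTheory.

Local Open Scope classical_set_scope.
Local Open Scope ring_scope.

(** A function [f Q] that presents the support [phi Q] of [H] at [Q] turns the
expected score of quoting [Q] under [P] into the number [phi Q P]. Propriety is
then the support inequality read through tangency at [P]:
[S(P,P) = phi P P = H P <= phi Q P = S(P,Q)], and the discrepancy is the gap
[phi Q P - H P] between the support at [Q] and [H] ([support_scoring_rule]).

A proper scoring rule is a loss function whose actions are the members of [PP];
quoting the true distribution is a Bayes act, so its diagonal is a coherent
uncertainty function ([proper_scoring_rule_coherent]). Coherence of [H]
therefore only asks for some choice of supports and presentations, which the
hypotheses and the axiom of choice provide ([exists_presented_supports]). *)

(** The action space is the subtype of [PP]: a quote outside [PP] need neither
have an expected score nor score at least [H P]. *)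
Lemma proper_scoring_rule_coherent (R : realType) (d : measure_display)
    (Z : measurableType d) (PP : set (pprobability Z R))
    (H : pprobability Z R -> R) (S : Z -> pprobability Z R -> R) :
  proper_scoring_rule PP S ->
  (forall P, PP P -> expected_score S P P = (H P)%:E) ->
  coherent_uncertainty PP H.
Proof.
move=> properS SH.
pose L z (a : {Q | PP Q}) := S z (sval a).
have bayesL P (PPP : PP P) : bayes_loss L P = expected_score S P P.
  apply/le_anti/andP; split.
    by apply: ereal_inf_lbound; exists (exist _ P PPP).
  apply: le_ereal_inf_tmp => _ [[Q PPQ] _ <-].
  by have [] := properS _ _ PPP PPQ.
exists {Q | PP Q}, L; split=> [|P PPP]; last by rewrite bayesL // SH.
split=> [P [Q PPQ] PPP|P PPP]; first by have [] := properS _ _ PPP PPQ.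
rewrite bayesL //; split; first by have [] := properS _ _ PPP PPP.
by exists (exist _ P PPP).
Qed.

Lemma support_scoring_rule (R : realType) (d : measure_display)
    (Z : measurableType d) (PP : set (pprobability Z R))
    (H : pprobability Z R -> R) (phi : pprobability Z R -> pprobability Z R -> R)
    (f : pprobability Z R -> Z -> R) :
  (forall Q, PP Q -> affine_support PP H Q (phi Q)) ->
  (forall Q, PP Q -> presents PP (f Q) (phi Q)) ->
  let S := fun (z : Z) (Q : pprobability Z R) => f Q z in
  [/\ proper_scoring_rule PP S,
      (forall P, PP P -> expected_score S P P = (H P)%:E) &
      (forall P Q, PP P -> PP Q -> discrepancy S P Q = (phi Q P - H P)%:E)].
Proof.
move=> supp pres S.
have score P Q : PP P -> PP Q -> expected_score S P Q = (phi Q P)%:E.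
  by move=> PPP PPQ; have [] := pres _ PPQ _ PPP.
have diag P : PP P -> expected_score S P P = (H P)%:E.
  by move=> PPP; rewrite score //; have [_ _ ->] := supp _ PPP.
split=> // [P Q PPP PPQ|P Q PPP PPQ].
- split; first by have [] := pres _ PPQ _ PPP.
    by rewrite diag.
  by rewrite diag // score // lee_fin; have [_ + _] := supp _ PPQ; apply.
- by rewrite /discrepancy diag // score.
Qed.

Lemma exists_presented_supports (R : realType) (d : measure_display)
    (Z : measurableType d) (PP : set (pprobability Z R))
    (H : pprobability Z R -> R) :
  (forall F, affine_on PP F -> presentable PP F) ->
  (forall Q, PP Q -> exists phi, affine_support PP H Q phi) ->
  exists (phi : pprobability Z R -> pprobability Z R -> R)
         (f : pprobability Z R -> Z -> R),
    (forall Q, PP Q -> affine_support PP H Q (phi Q)) /\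
    (forall Q, PP Q -> presents PP (f Q) (phi Q)).
Proof.
move=> presentPP suppH.
have /choice[g gP] (Q : pprobability Z R) :
    exists p : (pprobability Z R -> R) * (Z -> R),
      PP Q -> affine_support PP H Q p.1 /\ presents PP p.2 p.1.
  have [PPQ|nPPQ] := pselect (PP Q); last by exists (fun=> 0, fun=> 0).
  have [phi suppQ] := suppH _ PPQ.
  have [aff_phi _ _] := suppQ.
  by have [f presf] := presentPP _ aff_phi; exists (phi, f).
by exists (fun Q => (g Q).1), (fun Q => (g Q).2); split=> Q /gP[].
Qed.

Theorem mainTheorem3 (R : realType) (d : measure_display)
  (Z : measurableType d) (PP : set (pprobability Z R))
  (PP_convex : convex_family PP)
  (PP_presentable : forall F : pprobability Z R -> R,
      affine_on PP F -> presentable PP F)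
  (H : pprobability Z R -> R)
  (H_support : forall Q : pprobability Z R, PP Q ->
      exists phi : pprobability Z R -> R, affine_support PP H Q phi) :
  coherent_uncertainty PP H /\
  forall phi : pprobability Z R -> pprobability Z R -> R,
    (forall Q : pprobability Z R, PP Q -> affine_support PP H Q (phi Q)) ->
    forall f : pprobability Z R -> Z -> R,
      (forall Q : pprobability Z R, PP Q -> presents PP (f Q) (phi Q)) ->
      let S := fun (z : Z) (Q : pprobability Z R) => f Q z in
      [/\ proper_scoring_rule PP S,
          (forall P : pprobability Z R, PP P ->
             expected_score S P P = (H P)%:E) &
          (forall P Q : pprobability Z R, PP P -> PP Q ->
             discrepancy S P Q = (phi Q P - H P)%:E)].
Proof.
split=> [|phi supp f pres]; last exact: support_scoring_rule.
have [phi [f [supp pres]]] :=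
  @exists_presented_supports _ _ _ _ _ PP_presentable H_support.
have [properS SH _] := @support_scoring_rule _ _ _ _ _ _ _ supp pres.
exact: proper_scoring_rule_coherent properS SH.
Qed.
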